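(* Let $G$ be a planar graph and $\mathcal{H}$ a collection of subgraphs of $G$ such that $(G,\mathcal{H})$ is non-piercing. Then $(G,\mathcal{H})$ is cross-free.
   Context: $(G,\mathcal{H})$ is non-piercing if each $H\in\mathcal{H}$ is connected and for any $H,H'\in\mathcal{H}$ the subgraph of $G$ induced on $V(H)\setminus V(H')$ is connected. For an embedding of $G$ and $H,H'\in\mathcal{H}$, the reduced graph $R(H,H')$ is obtained by contracting all edges with both endpoints in $V(H)\cap V(H')$; $H,H'$ are cross-free at $v\in V(H)\cap V(H')$ if in $R(H,H')$ there are no four edges $\{\tilde v,v_i\}$ around the image $\tilde v$ of $v$, in cyclic order $i=1,\dots,4$, with $v_1,v_3\in V(H)\setminus V(H')$, $v_2,v_4\in V(H')\setminus V(H)$. $(G,\mathcal{H})$ is cross-free if there is an embedding (here, in the plane) of $G$ in which every pair of members of $\mathcal{H}$ is cross-free at every common vertex. *)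

(* Defs.v *)
From mathcomp Require Import all_boot fingroup perm.

Set Implicit Arguments.
Unset Strict Implicit.
Unset Printing Implicit Defensive.

Record sgraph := SGraph {
  vertex :> finType;
  adj : rel vertex;
  adj_sym : symmetric adj;
  adj_irr : irreflexive adj
}.

(* Subgraphs are arbitrary, not only induced ones. *)
Record subgraph (G : sgraph) := Subgraph {
  sV : {set G};
  sE : rel G;
  sE_sym : symmetric sE;
  sE_sub : forall x y, sE x y -> [&& x \in sV, y \in sV & adj x y]
}.

Section Induced.
Variables (G : sgraph) (S : {set G}).

Definition induced_rel : rel G := [rel x y | [&& x \in S, y \in S & adj x y]].

Lemma induced_sym : symmetric induced_rel.
Proof. by move=> x y; rewrite /induced_rel /= adj_sym andbCA. Qed.

Definition induced : subgraph G := Subgraph induced_sym (fun _ _ h => h).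
End Induced.

(* The empty subgraph counts as connected: V(H) \ V(H') is empty for H = H'. *)
Definition connected (G : sgraph) (K : subgraph G) : Prop :=
  forall x y, x \in sV K -> y \in sV K -> connect (@sE G K) x y.

Definition non_piercing (G : sgraph) (I : Type) (H : I -> subgraph G) : Prop :=
  (forall i, connected (H i)) /\
  (forall i j, connected (induced (sV (H i) :\: sV (H j)))).

(* A dart (x, y) is the edge {x, y} seen from its end x. *)
Definition dart (G : sgraph) := {d : G * G | adj d.1 d.2}.

Section Darts.
Variable G : sgraph.
Implicit Type d : dart G.

Lemma rev_subproof d : adj ((val d).2, (val d).1).1 ((val d).2, (val d).1).2.
Proof. by rewrite /= adj_sym (valP d). Qed.

Definition rev d : dart G := exist _ ((val d).2, (val d).1) (rev_subproof d).

Lemma revK : involutive rev.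
Proof. by move=> d; apply: val_inj => /=; case: (val d). Qed.

Definition revp : {perm dart G} := perm (can_inj revK).
End Darts.

(* Embeddings are given combinatorially, up to homeomorphism, by the cyclic   *)
(* order (say, counterclockwise) of the darts around each vertex.             *)
Definition rotation_system (G : sgraph) (rot : {perm dart G}) : Prop :=
  forall d e, (e \in porbit rot d) = ((val e).1 == (val d).1).

(* The orbits of revp * rot, d |-> rot (rev d), are the face boundaries, taken *)
(* separately in each connected component. The formula is the sum over the    *)
(* components of V - E + F = 2; since V - E + F <= 2 always holds, it says    *)
(* that every component is embedded in the sphere. Isolated vertices have no  *)
(* darts, and the position of the components relative to each other is not    *)
(* recorded: neither affects the cyclic orders or their existence.            *)
Definition plane_embedding (G : sgraph) (rot : {perm dart G}) : Prop :=
  rotation_system rot /\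
  #|porbits rot| + #|porbits (revp G * rot)%g| =
  #|porbits (revp G)| +
    2 * n_comp [rel d e | (e == rev d) || (e == rot d)] [pred _ : dart G | true].

Definition planar (G : sgraph) : Prop :=
  exists rot : {perm dart G}, plane_embedding rot.

(* Embedded multigraphs obtained from an embedding of G by contracting edges: *)
(* [image] sends a vertex of G to the representative of its image, the edges  *)
(* are the surviving edges of G, and [mrot] is the rotation of the surviving  *)
(* darts (the other darts are fixed by it).                                   *)
Record embmg (G : sgraph) := Embmg {
  image : G -> G;
  mdarts : {set dart G};
  mrot : {perm dart G}
}.

Section Contraction.
Variable G : sgraph.
Implicit Types (M : embmg G) (d : dart G) (s : {perm dart G}).

Definition origin M d : G := image M (val d).1.
Definition target M d : G := image M (val d).2.

Definition embmg_of (rot : {perm dart G}) : embmg G := Embmg id setT rot.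

(* Takes d out of its cycle in s, and makes it a fixed point. *)
Definition skip d s : {perm dart G} := (s * tperm d (s d))%g.

Definition skip_edge d s : {perm dart G} := skip (rev d) (skip d s).

(* tperm d (rev d) * s merges the cycles of d and rev d when these are        *)
(* distinct: the other darts at the target of d are inserted, in their order, *)
(* at the place of d. An edge that has become a loop is deleted, and nothing  *)
(* happens to an edge that is already contracted or deleted.                  *)
Definition contract M d : embmg G :=
  let del := mdarts M :\: [set d; rev d] in
  if origin M d == target M d then
    Embmg (image M) del (skip_edge d (mrot M))
  else
    Embmg (fun x => if image M x == target M d then origin M d else image M x)
          del (skip_edge d (tperm d (rev d) * mrot M)%g).

Definition inside (S : {set G}) : {set dart G} :=
  [set d | ((val d).1 \in S) && ((val d).2 \in S)].

(* R results from contracting all edges with both ends in S, in some order.   *)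
(* The underlying graph of R does not depend on the order, but when G[S] has  *)
(* cycles the rotation of R does.                                             *)
Definition reduced (rot : {perm dart G}) (S : {set G}) (R : embmg G) : Prop :=
  exists2 s : seq (dart G),
    perm_eq s (enum (inside S)) & R = foldl contract (embmg_of rot) s.

(* Four distinct edges around the image of v, in this cyclic order; parallel  *)
(* edges are allowed.                                                         *)
Definition edges_around (R : embmg G) (v : G) (d1 d2 d3 d4 : dart G) : Prop :=
  [/\ {subset [:: d1; d2; d3; d4] <= mdarts R},
      {in [:: d1; d2; d3; d4], forall d, origin R d = image R v} &
      subseq [:: d1; d2; d3; d4] (orbit (mrot R) d1)].

(* Required whatever the order of the contractions. *)
Definition cross_free_at (rot : {perm dart G}) (H H' : subgraph G) (v : G) :=
  forall R : embmg G, reduced rot (sV H :&: sV H') R ->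
  ~ exists d1 d2 d3 d4 : dart G,
      [/\ edges_around R v d1 d2 d3 d4,
          target R d1 \in sV H :\: sV H',
          target R d2 \in sV H' :\: sV H,
          target R d3 \in sV H :\: sV H' &
          target R d4 \in sV H' :\: sV H].
End Contraction.

Definition cross_free (G : sgraph) (I : Type) (H : I -> subgraph G) : Prop :=
  exists rot : {perm dart G}, plane_embedding rot /\
    forall (i j : I) (v : G),
      v \in sV (H i) :&: sV (H j) -> cross_free_at rot (H i) (H j) v.

(* Main.v *)
(* Any plane embedding works. Deleting an edge, or contracting one that is    *)
(* not a loop, does not increase the genus (E + 2c - V - F)/2, so every       *)
(* reduced graph is plane. If four edges around the image of v alternated     *)
(* between A = V(H) \ V(H') and B = V(H') \ V(H), one could delete all other  *)
(* edges except those inside A or inside B and contract the latter, since     *)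
(* G[A] and G[B] are connected. This leaves three vertices with four edges,   *)
(* in the rotation A, B, A, B around the first one: a connected map with a    *)
(* single face, which is not plane.                                           *)

From mathcomp Require Import all_boot fingroup perm zify.
Require Import Defs.

Set Implicit Arguments.
Unset Strict Implicit.
Unset Printing Implicit Defensive.

Lemma n_comp_leS (T : finType) (e e' : rel T) (y : T) :
    connect_sym e -> connect_sym e' ->
    (forall u v, connect e u v -> ~~ connect e' u y -> ~~ connect e' v y ->
       connect e' u v) ->
  n_comp e' T <= (n_comp e T).+1.
Proof.
move=> sym_e sym_e' sub_ee'; rewrite /n_comp_mem.
rewrite (cardD1 (root e' y)) -[leqRHS]add1n leq_add ?leq_b1 //.
rewrite -(card_in_imset (f := root e)) => [|u v /=].
  apply/subset_leq_card/subsetP => _ /imsetP[u _ ->].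
  by rewrite inE /= roots_root.
rewrite !inE !andbT => /andP[y'u /eqP u_root] /andP[y'v /eqP v_root].
move/eqP; rewrite (root_connect sym_e) => uv.
rewrite -u_root -v_root; apply/eqP; rewrite (root_connect sym_e').
apply: sub_ee' => //; rewrite -(root_connect sym_e') ?u_root ?v_root //.
Qed.

Lemma porbit_mul_tperm (T : finType) (s : {perm T}) x y :
  x != y -> (x \in porbit (tperm x y * s)%g y) = (x \notin porbit s y).
Proof.
move=> x'y; have := porbits_mul_tperm s x y.
have /= := porbits_mul_tperm (tperm x y * s)%g x y.
rewrite mulgA tperm2 mul1g x'y.
by case: (x \in _); case: (x \in _) => /=; lia.
Qed.

(** * The genus of a rotation *)

Section Genus.
Variables (D : finType) (e : {perm D}).
Hypotheses (e2 : (e * e = 1)%g) (e_neq : forall d, e d != d).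
Implicit Types (x y z d : D) (m n : {perm D}).

Lemma eK : involutive e.
Proof. by move=> d; rewrite -permM e2 perm1. Qed.

Lemma eV : (e^-1 = e)%g.
Proof. by apply/eqP; rewrite eq_invg_mul e2. Qed.

Definition glink n : rel (D) := [rel d f | (f == e d) || (f == n d)].
Definition ncomp n := n_comp (glink n) [pred _ : D | true].

Lemma glink_e n d : connect (glink n) d (e d).
Proof. by apply: connect1; apply/orP; left. Qed.

Lemma glink_rot n d : connect (glink n) d (n d).
Proof. by apply: connect1; apply/orP; right. Qed.

Lemma glink_orbit n x y : y \in porbit n x -> connect (glink n) x y.
Proof.
case/porbitP => i ->{y}; elim: i => [|i IH]; first by rewrite perm1.
by rewrite expgSr permM (connect_trans IH) ?glink_rot.
Qed.

Lemma glink_face n x y : y \in porbit (e * n)%g x -> connect (glink n) x y.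
Proof.
case/porbitP => i ->{y}; elim: i => [|i IH]; first by rewrite perm1.
rewrite expgSr !permM (connect_trans IH) //.
exact: connect_trans (glink_e _ _) (glink_rot _ _).
Qed.

Lemma glink_sym n : connect_sym (glink n).
Proof.
suff sub u v : connect (glink n) u v -> connect (glink n) v u.
  by move=> u v; apply/idP/idP; apply: sub.
have /= <- := connect_rev (glink n) u v.
apply: connect_sub => {}u {}v uv; have /= -> := connect_rev (glink n) u v; move: uv.
case/orP=> /eqP ->; first by rewrite -{2}[u]eK glink_e.
by rewrite glink_orbit // porbit_sym (mem_porbit n 1).
Qed.

Lemma glink_tperm_sub n x y :
  connect (glink (tperm x y * n)) x y ->
  subrel (connect (glink n)) (connect (glink (tperm x y * n))).
Proof.
move=> xy; apply: connect_sub => u v /= /orP[] /eqP -> {v}.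
  exact: glink_e.
have -> : n u = (tperm x y * n)%g (tperm x y u) by rewrite permM tpermK.
apply: connect_trans (glink_rot _ _).
by case: tpermP => [->|->|_ _] //; rewrite glink_sym.
Qed.

Lemma tpermKM x y n : (tperm x y * (tperm x y * n) = n)%g.
Proof. by rewrite mulgA tperm2 mul1g. Qed.

Lemma ncomp_tperm n x y :
    connect (glink n) x y -> connect (glink (tperm x y * n)) x y ->
  ncomp (tperm x y * n) = ncomp n.
Proof.
move=> xy xy'; apply: eq_n_comp => u v; apply/idP/idP; last exact: glink_tperm_sub.
by have := @glink_tperm_sub (tperm x y * n)%g x y; rewrite tpermKM; apply.
Qed.

Lemma ncomp_tperm_leS n x y : ncomp (tperm x y * n) <= (ncomp n).+1.
Proof.
set n' := (tperm x y * n)%g.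
have cut u v : connect (glink n) u v ->
    [|| connect (glink n') u v, connect (glink n') u x | connect (glink n') u y].
  case/connectP=> p + ->; elim: p u => [|w p IH] u //=; first by rewrite connect0.
  case/andP=> uw /IH{IH}; have [->|x'u] := eqVneq u x; first by rewrite connect0 !orbT.
  have [->|y'u] := eqVneq u y; first by rewrite connect0 !orbT.
  suff wu : connect (glink n') w u by rewrite !(same_connect (glink_sym n') wu).
  rewrite glink_sym; case/orP: uw => /eqP ->; first exact: glink_e.
  have -> : n u = n' u by rewrite permM tpermD // eq_sym.
  exact: glink_rot.
apply: (n_comp_leS (y := y)); try exact: glink_sym.
move=> u v uv /negPf uy /negPf vy.
have := cut u v uv; rewrite uy orbF => /orP[//|ux].
have := cut v u; rewrite glink_sym => /(_ uv); rewrite vy orbF.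
by case/orP=> [|vx]; rewrite glink_sym // (connect_trans vx) // glink_sym.
Qed.

Definition nverts n := #|porbits n|.
Definition nfaces n := #|porbits (e * n)|.

(* Twice the genus is E + 2c - V - F, where c counts the components; E, the   *)
(* number of orbits of [e], does not depend on the rotation.                  *)
Definition genus_le m n :=
  nverts n + nfaces n + 2 * ncomp m <= nverts m + nfaces m + 2 * ncomp n.

Lemma genus_le_refl n : genus_le n n. Proof. exact: leqnn. Qed.

Lemma genus_le_trans n m p : genus_le m n -> genus_le n p -> genus_le m p.
Proof. by rewrite /genus_le; lia. Qed.

Lemma face_tperm n x y :
  (e * (tperm x y * n) = tperm (e x) (e y) * (e * n))%g.
Proof.
rewrite -tpermJ conjgE -!mulgA [(e * (e * n))%g]mulgA e2.
by rewrite mul1g eV.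
Qed.

Lemma nverts_tperm n x y :
  nverts (tperm x y * n) + (x \notin porbit n y).*2 = nverts n + (x != y).
Proof. exact: porbits_mul_tperm. Qed.

Lemma nfaces_tperm n x y :
  nfaces (tperm x y * n) + (e x \notin porbit (e * n)%g (e y)).*2
    = nfaces n + (x != y).
Proof. by rewrite /nfaces face_tperm porbits_mul_tperm (inj_eq perm_inj). Qed.

Lemma glink_same_face n x y :
  e x \in porbit (e * n)%g (e y) -> connect (glink n) x y.
Proof.
rewrite porbit_sym => /glink_face xy.
rewrite (connect_trans (glink_e n x)) // (connect_trans xy) //.
by rewrite glink_sym glink_e.
Qed.

Lemma genus_le_tperm n x y :
    (x \in porbit n y) || (e x \in porbit (e * n)%g (e y)) ->
  genus_le (tperm x y * n) n.
Proof.
have [<- _|x'y] := eqVneq x y; first by rewrite tperm1 mul1g; exact: genus_le_refl.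
have V_eq := nverts_tperm n x y; have F_eq := nfaces_tperm n x y.
have c_le := ncomp_tperm_leS n x y.
rewrite /genus_le; move: V_eq F_eq; rewrite x'y.
have [nxy|nxy] := boolP (x \in porbit n y).
  have [_|fxy] := boolP (e x \in _); first by lia.
  rewrite ncomp_tperm; first by lia.
    by rewrite glink_sym glink_orbit.
  by rewrite glink_same_face // face_tperm porbit_mul_tperm ?(inj_eq perm_inj).
have [fxy|//] := boolP (e x \in _).
rewrite ncomp_tperm; [by lia|exact: glink_same_face|].
by rewrite glink_sym glink_orbit // porbit_mul_tperm.
Qed.

Lemma genus_lt_tperm n x y :
    x != y -> x \in porbit n y -> e x \in porbit (e * n)%g (e y) ->
    connect (glink (tperm x y * n)) x y ->
  ~~ genus_le n (tperm x y * n).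
Proof.
move=> x'y nxy fxy xy'.
have := ncomp_tperm (glink_same_face fxy) xy'.
have := nfaces_tperm n x y; have := nverts_tperm n x y.
by rewrite /genus_le x'y nxy fxy /=; lia.
Qed.

(* [skip] and [skip_edge] of Defs.v, with [e] in place of [rev]. *)
Definition pskip d n : {perm D} := (n * tperm d (n d))%g.
Definition pskip_edge d n : {perm D} := pskip (e d) (pskip d n).

Lemma pskip_tperm d n : pskip d n = (tperm (n^-1 d) d * n)%g.
Proof.
have := tpermJ ((n^-1)%g d) d n; rewrite permKV /pskip => <-.
by rewrite conjgE !mulgA mulgV mul1g.
Qed.

Lemma pskipE d n x :
  pskip d n x = if x == d then d else if n x == d then n d else n x.
Proof.
rewrite /pskip permM; have [->|x'd] := eqVneq x d; first by rewrite tpermR.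
case: tpermP => [->|/perm_inj /eqP|]; rewrite ?eqxx ?(negPf x'd) //.
by move=> /eqP/negPf ->.
Qed.

Lemma genus_le_pskip d n : genus_le (pskip d n) n.
Proof.
rewrite pskip_tperm genus_le_tperm //; apply/orP; left.
by rewrite porbit_sym -{1}[d](permKV n) (mem_porbit n 1).
Qed.

Lemma genus_le_pskip_edge d n : genus_le (pskip_edge d n) n.
Proof. exact: genus_le_trans (genus_le_pskip _ _) (genus_le_pskip _ _). Qed.

Lemma pskip_edgeE d n x :
  pskip_edge d n x =
    if (x == d) || (x == e d) then x else
    let s z := if n z == d then n d else n z in
    if s x == e d then s (e d) else s x.
Proof.
rewrite /pskip_edge !pskipE /= (negPf (e_neq d)).
have [->|x'rd] := eqVneq x (e d); first by rewrite orbT.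
have [->|x'd] /= := eqVneq x d; last by [].
by rewrite eq_sym (negPf (e_neq d)).
Qed.

(* The two transpositions differ only in where d and e d end up in the merged *)
(* cycle; the corners that the one on the right joins lie on the same face,   *)
(* so that it does not raise the genus.                                       *)
Lemma pskip_edge_merge d n :
  pskip_edge d (tperm d (e d) * n)%g =
  pskip_edge d (tperm d (n^-1 (e d)) * n)%g.
Proof.
apply/permP => x; rewrite !pskip_edgeE.
case: ifP => // /norP[x'd x'ed]; rewrite /= !permM.
have ed'd : (d == e d) = false by rewrite eq_sym (negPf (e_neq d)).
set y := (n^-1)%g (e d); have ny : n y = e d by rewrite permKV.
have -> : tperm d (e d) x = x by rewrite tpermD // eq_sym.
rewrite !tpermL tpermR ny.
have [E|x'y] := eqVneq x y.
  rewrite E tpermR ny (negPf (e_neq d)) eqxx.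
  have [nd|n'd] := eqVneq (n d) d.
    have -> : tperm d y (e d) = e d by rewrite tpermD ?ed'd -?E.
    rewrite eqxx; case: eqVneq => // ned; case/eqP: (e_neq d).
    by apply: (@perm_inj _ n); rewrite ned.
  case: eqVneq => // nd; case/eqP: x'd; apply: (@perm_inj _ n).
  by rewrite E ny.
have nx : (n x == e d) = false by rewrite -ny (inj_eq perm_inj) (negPf x'y).
have -> : tperm d y x = x by rewrite tpermD // eq_sym.
have [nxd|_] /= := eqVneq (n x) d; last by rewrite nx.
have n'd u : x != u -> (n u == d) = false.
  by move=> x'u; rewrite -nxd (inj_eq perm_inj) eq_sym (negPf x'u).
rewrite eqxx (n'd d) //.
have [E|y'ed] := eqVneq (e d) y.
  by rewrite -E tpermR (n'd d) // E ny -E eqxx.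
have -> : tperm d y (e d) = e d by rewrite tpermD // ?ed'd // eq_sym.
rewrite (n'd (e d)) //.
by rewrite -{2}ny (inj_eq perm_inj) (negPf y'ed).
Qed.

Lemma genus_le_merge d n : genus_le (tperm d (n^-1 (e d)) * n)%g n.
Proof.
apply: genus_le_tperm; apply/orP; right.
by apply/porbitP; exists 1; rewrite expg1 permM eK permKV.
Qed.

Lemma genus_le_contract d n : genus_le (pskip_edge d (tperm d (e d) * n)) n.
Proof.
rewrite pskip_edge_merge.
exact: genus_le_trans (genus_le_pskip_edge _ _) (genus_le_merge _ _).
Qed.

Lemma pskip_fixed d n x : n x = x -> pskip d n x = x.
Proof. by move=> nx; rewrite pskipE nx; case: eqP => [->|]. Qed.

Lemma ncomp1_ge : #|D| <= 2 * ncomp 1.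
Proof.
set R := [set x | roots (glink 1) x].
have cR : ncomp 1 = #|R|.
  by rewrite cardsE; apply: eq_card => x; rewrite !inE andbT.
have sub : [set: D] \subset R :|: e @: R.
  apply/subsetP => x _; have := connect_root (glink 1) x.
  set r := root _ x => xr; have rR : r \in R by rewrite inE roots_root //; exact: glink_sym.
  have cl : closed (glink 1) [set x; e x].
    apply: intro_closed; first exact: glink_sym.
    move=> u v /orP[] /eqP ->; rewrite ?perm1 // !inE.
    by case/orP => /eqP ->; rewrite ?eK eqxx ?orbT.
  have := closed_connect cl xr; rewrite !inE eqxx /= => /esym/orP[]/eqP rx.
    by move: rR; rewrite inE rx => ->.
  by apply/orP; right; apply/imsetP; exists r; rewrite // rx eK.
rewrite -cardsT (leq_trans (subset_leq_card sub)) // cardsU.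
by have := leq_imset_card e R; rewrite cR; lia.
Qed.

Lemma euler_le n : nverts n + nfaces n <= #|porbits e| + 2 * ncomp n.
Proof.
have [m mn fix_m] : exists2 m, genus_le m n & forall x, x \in enum D -> m x = x.
  elim: (enum D) => [|x s [m mn fix_m]]; first by exists n; rewrite ?genus_le_refl.
  exists (pskip x m); first exact: genus_le_trans (genus_le_pskip _ _) mn.
  move=> y; rewrite inE => /predU1P[->|/fix_m/pskip_fixed //].
  by rewrite pskipE eqxx.
have m1 : m = 1%g by apply/permP => x; rewrite perm1 fix_m ?mem_enum.
have V1 : nverts 1 <= #|D|.
  by rewrite -cardsT (leq_trans (leq_imset_card _ _)) // cardsT.
have F1 : nfaces 1 = #|porbits e| by rewrite /nfaces mulg1.
by have := ncomp1_ge; move: mn; rewrite m1 /genus_le; lia.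
Qed.

End Genus.

(** * Deletions and contractions *)

Section Reductions.
Variables (D : finType) (e : {perm D}).
Hypotheses (e2 : (e * e = 1)%g) (e_neq : forall d, e d != d).
Implicit Types (x y z d : D) (m n : {perm D}).

Definition invariant_under T n (f : D -> T) := forall x, f (n x) = f x.

Lemma invariant_porbit T n (f : D -> T) x y :
  invariant_under n f -> y \in porbit n x -> f y = f x.
Proof.
move=> nf /porbitP[i ->]; elim: i => [|i IH]; first by rewrite perm1.
by rewrite expgSr permM nf.
Qed.

Lemma pskip_invariant T d n (f : D -> T) :
  invariant_under n f -> invariant_under (pskip d n) f.
Proof.
by move=> nf x; rewrite pskipE; case: eqP => [->|_] //; case: eqP => [<-|_]; rewrite !nf.
Qed.

Lemma pskip_pull d n (p : D -> bool) :
    invariant_under (pskip d n) p ->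
  exists2 q, invariant_under n q & forall x, x != d -> q x = p x.
Proof.
move=> np; exists (fun x => if x == d then p (n d) else p x); last first.
  by move=> x /negPf ->.
move=> x; have := np x; rewrite pskipE.
have [->|x'd] := eqVneq x d; first by case: eqP => [->|].
by case: eqP.
Qed.

Lemma pskip_edge_fixed d n : pskip_edge e d n d = d /\ pskip_edge e d n (e d) = e d.
Proof. by rewrite !(pskip_edgeE e_neq) !eqxx orbT. Qed.

Lemma pskip_edge_frame d n x :
    x \notin [:: d; e d] -> n x \notin [:: d; e d] ->
  pskip_edge e d n x = n x.
Proof.
rewrite !inE !negb_or (pskip_edgeE e_neq) => /andP[/negPf -> /negPf ->].
by move=> /andP[/negPf /= -> /negPf ->].
Qed.

Lemma pskip_edge_pull d n (p : D -> bool) :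
    invariant_under (pskip_edge e d n) p ->
  exists2 q, invariant_under n q & forall x, x \notin [:: d; e d] -> q x = p x.
Proof.
case/pskip_pull => q1 nq1 q1p; case/pskip_pull: nq1 => q nq qq1.
exists q => // x; rewrite !inE negb_or => /andP[x'd x'ed].
by rewrite qq1 ?q1p.
Qed.

Lemma collapse d n : exists m,
  [/\ genus_le e m n, m d = d, m (e d) = e d,
      forall x, x \notin [:: d; e d] -> n x \notin [:: d; e d] -> m x = n x &
      (forall T (f : D -> T),
         invariant_under n f -> f d = f (e d) -> invariant_under m f) /\
      (forall p : D -> bool, invariant_under m p ->
         exists q, [/\ invariant_under n q, q d = q (e d) &
                       forall x, x \notin [:: d; e d] -> q x = p x])].
Proof.
have [nd|nd] := boolP (e d \in porbit n d).
  have [md med] := pskip_edge_fixed d n.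
  exists (pskip_edge e d n); split=> //; first exact: genus_le_pskip_edge.
    by move=> x; apply: pskip_edge_frame.
  split=> [T f nf _|p /pskip_edge_pull[q nq qp]].
    by do 2!apply: pskip_invariant.
  by exists q; split; rewrite ?(invariant_porbit nq nd).
set y := (n^-1)%g (e d); have ny : n y = e d by rewrite permKV.
set w := (tperm d y * n)%g.
have [md med] := pskip_edge_fixed d w.
exists (pskip_edge e d w); split=> //.
- apply: genus_le_trans (genus_le_merge e2 _ _).
  exact: genus_le_pskip_edge.
- move=> x xd nxd; suff wx : w x = n x by rewrite pskip_edge_frame ?wx.
  rewrite permM tpermD // eq_sym; first by move: xd; rewrite !inE; case: eqP.
  by move: nxd; apply: contra => /eqP ->; rewrite ny !inE eqxx orbT.
split=> [T f nf fd|p /pskip_edge_pull[q wq qp]].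
  do 2!apply: pskip_invariant; move=> x; rewrite permM.
  by case: tpermP => [->|->|_ _]; rewrite ?ny ?nf // -(nf y) ny.
have d'y : d != y.
  by apply: contraNneq nd => dy; rewrite -ny -dy (mem_porbit n 1).
have wy : d \in porbit w y.
  rewrite porbit_mul_tperm // -eq_porbit_mem -(porbit_perm n 1 y) /= expg1 ny.
  by rewrite eq_porbit_mem porbit_sym.
have qdy := invariant_porbit wq wy.
exists q; split=> // [x|].
  have -> : n x = w (tperm d y x) by rewrite permM tpermK.
  by rewrite wq; case: tpermP => [->|->|].
by rewrite -[in LHS]wq /w permM tpermL ny.
Qed.

(* [None] marks the darts that play no role in connecting others. *)
Variable col : D -> option bool.

(* x and y lie in one component of the graph whose vertices are the cycles of *)
(* n and whose edges are those with both ends of the same colour.             *)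
Definition joined n x y := forall p : D -> bool,
  invariant_under n p ->
  (forall z, col z -> col z = col (e z) -> p z = p (e z)) -> p x = p y.

Variable U : pred D.
Hypothesis U_e : forall x, U (e x) = U x.

Definition reduces m n :=
  [/\ genus_le e m n, invariant_under m col &
      forall x y, U x -> U y -> joined n x y -> joined m x y].

Lemma reduces_refl n : invariant_under n col -> reduces n n.
Proof. by split; first exact: genus_le_refl. Qed.

Lemma reduces_trans n m k : reduces m n -> reduces n k -> reduces m k.
Proof.
move=> [mn mcol mj] [nk ncol nj]; split=> //; first exact: genus_le_trans nk.
by move=> x y Ux Uy /nj/mj; apply.
Qed.

Lemma reduces_pskip n z :
  invariant_under n col -> col z = None -> ~~ U z -> reduces (pskip z n) n.
Proof.
move=> ncol zN z'U; split; first exact: genus_le_pskip.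
  exact: pskip_invariant.
move=> x y Ux Uy nxy p /pskip_pull[q nq qp] pe.
have x'z : x != z by apply: contraNneq z'U => <-.
have y'z : y != z by apply: contraNneq z'U => <-.
rewrite -!qp //; apply: nxy => // t t_col tE.
have t'z : t != z by apply: contraTneq t_col => ->; rewrite zN.
have et'z : e t != z by apply: contraTneq t_col => etz; rewrite tE etz zN.
by rewrite !qp // pe.
Qed.

Lemma notin_unmarked z x : ~~ U z -> U x -> x \notin [:: z; e z].
Proof.
move=> z'U Ux; rewrite !inE negb_or; apply/andP; split.
  by apply: contraNneq z'U => <-.
by apply: contraNneq z'U => xE; rewrite -U_e -xE.
Qed.

Lemma reduces_step n z :
    invariant_under n col -> ~~ U z ->
  exists m, [/\ reduces m n, m z = z, m (e z) = e z &
    forall x, x \notin [:: z; e z] -> n x \notin [:: z; e z] -> m x = n x].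
Proof.
move=> ncol z'U.
have notz x := @notin_unmarked z x z'U.
have [zE|zE] := eqVneq (col z) (col (e z)).
  have [m [mn mz mez frame [inv pull]]] := collapse z n.
  exists m; split=> //; split=> //; first exact: inv.
  move=> x y Ux Uy nxy p /pull[q [nq qz qp]] pe.
  rewrite -!qp ?notz //; apply: nxy => // t t_col tE.
  have [|t'z] := boolP (t \in [:: z; e z]).
    by rewrite !inE => /orP[]/eqP ->; rewrite ?(eK e2).
  have et'z : e t \notin [:: z; e z].
    apply: contra t'z; rewrite !inE => /orP[]/eqP; last by move/perm_inj->; rewrite eqxx.
    by move=> <-; rewrite (eK e2) eqxx orbT.
  by rewrite !qp // pe.
have [mz mez] := pskip_edge_fixed z n.
exists (pskip_edge e z n); split=> //; last exact: pskip_edge_frame.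
split; first exact: genus_le_pskip_edge.
  by do 2!apply: pskip_invariant.
move=> x y Ux Uy nxy p /pskip_edge_pull[q nq qp] pe.
rewrite -!qp ?notz //; apply: nxy => // t t_col tE.
have t'z : t \notin [:: z; e z].
  by apply: contraNN zE; rewrite !inE => /orP[]/eqP E; move: tE; rewrite E ?(eK e2) => ->.
have et'z : e t \notin [:: z; e z].
  apply: contra t'z; rewrite !inE => /orP[]/eqP; last by move/perm_inj->; rewrite eqxx.
  by move=> <-; rewrite (eK e2) eqxx orbT.
by rewrite !qp // pe.
Qed.

Lemma reduces_all n (s : seq D) :
    invariant_under n col ->
  exists m, [/\ reduces m n, forall x, x \in s -> ~~ U x -> m x = x &
    forall x, U x -> U (n x) -> m x = n x].
Proof.
move=> ncol; elim: s => [|z s [m [mn fix_m frame_m]]].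
  by exists n; split=> //; apply: reduces_refl.
have [Uz|z'U] := boolP (U z).
  exists m; split=> // x; rewrite inE => /predU1P[->|/fix_m //].
  by rewrite Uz.
have [_ mcol _] := mn.
have [k [km kz kez frame_k]] := reduces_step mcol z'U.
have notz x := @notin_unmarked z x z'U.
exists k; split; first exact: reduces_trans km mn.
  move=> x; rewrite inE => /predU1P[-> //|/fix_m mx x'U].
  have [|x'z] := boolP (x \in [:: z; e z]).
    by rewrite !inE => /orP[]/eqP ->.
  by rewrite frame_k ?mx.
by move=> x Ux Unx; rewrite frame_k ?frame_m ?notz.
Qed.

Lemma fcycle_pskip n (z : D) l r :
  uniq (l ++ z :: r) -> fcycle n (l ++ z :: r) -> fcycle (pskip z n) (l ++ r).
Proof.
rewrite -(rot_uniq (size l)) -(rot_cycle (size l) (frel n)).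
rewrite -(rot_cycle (size l) (frel (pskip z n))).
rewrite !rot_size_cat /=; case: (r ++ l) => [|a w] //=.
rewrite !rcons_path => /andP[z'aw _] /andP[/eqP nz /andP[nw /eqP lz]].
apply/andP; split; last first.
  have /negPf z'last : last a w != z.
    by apply: contraNneq z'aw => <-; rewrite mem_last.
  by rewrite /= pskipE z'last lz eqxx nz.
elim: w a {nz lz} z'aw nw => //= b w IH a; rewrite inE negb_or => /andP[z'a z'bw].
case/andP=> /eqP nab nw; rewrite IH // andbT pskipE [a == z]eq_sym (negPf z'a) nab.
by move: z'bw; rewrite inE negb_or eq_sym => /andP[/negPf ->].
Qed.

Lemma reduces_cycle n l r :
    invariant_under n col -> uniq (l ++ r) -> fcycle n (l ++ r) ->
    {in r, forall z, col z = None} ->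
  exists2 m, reduces m n & fcycle m (l ++ filter U r).
Proof.
elim: r l n => [|z r IH] l n ncol ulr nlr rN; first by exists n => //; apply: reduces_refl.
have rN' : {in r, forall z, col z = None} by move=> t tr; rewrite rN // inE tr orbT.
rewrite /=; have [Uz|z'U] := boolP (U z).
  by rewrite -cat_rcons; apply: IH; rewrite ?cat_rcons.
have skip_n := reduces_pskip ncol (rN z (mem_head _ _)) z'U.
have [_ mcol _] := skip_n.
have ulr' : uniq (l ++ r) by apply: subseq_uniq ulr; rewrite cat_subseq ?subseq_cons.
have [k km nk] := IH l (pskip z n) mcol ulr' (fcycle_pskip ulr nlr) rN'.
by exists k => //; apply: reduces_trans km skip_n.
Qed.

End Reductions.

(** * Crossings *)

Section Crossing.
Variables (D : finType) (e : {perm D}).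
Implicit Types (x z : D) (n : {perm D}).
Variable col : D -> option bool.
Variable U : pred D.
Hypothesis U_mono : forall z, col z -> col z = col (e z) -> ~~ U z /\ ~~ U (e z).

Lemma joined_two n u v :
    invariant_under n col -> (forall x, ~~ U x -> n x = x) -> U u -> u != v ->
    (forall x, U x -> col x = col u -> x = u \/ x = v) ->
    joined e col n u v ->
  n u = v.
Proof.
move=> ncol fix_n Uu u'v uv nuv.
suff nu : n u <> u.
  have Unu : U (n u).
    by case: (boolP (U (n u))) => // /fix_n/perm_inj.
  by case: (uv _ Unu (ncol u)).
move=> nu; have := nuv (fun x => x == u); rewrite eqxx eq_sym (negPf u'v) => H.
suff : true = false by [].
apply: H => [x|z z_col zE]; first by rewrite -{1}nu (inj_eq perm_inj).
have [z'U ez'U] := U_mono z_col zE.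
have /negPf -> : z != u by apply: contraNneq z'U => ->.
by have /negPf -> : e z != u by apply: contraNneq ez'U => ->.
Qed.

End Crossing.

Lemma joined_sym (D : finType) (e : {perm D}) col n x y :
  joined e col n x y -> joined e col n y x.
Proof. by move=> nxy p np pe; rewrite (nxy p np pe). Qed.

Section NoCrossing.
Variables (D : finType) (e : {perm D}).
Hypotheses (e2 : (e * e = 1)%g) (e_neq : forall d, e d != d).

(* Only eight darts are left, and they bound a single face; cutting [d1] off  *)
(* its vertex splits this face without disconnecting anything.                *)
Lemma crossing_genus (n : {perm D}) d1 d2 d3 d4 :
    let ds := [:: d1; d2; d3; d4] in
    uniq ds -> {in ds, forall x, e x \notin ds} ->
    n d1 = d2 -> n d2 = d3 -> n d3 = d4 -> n d4 = d1 ->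
    n (e d1) = e d3 -> n (e d3) = e d1 -> n (e d2) = e d4 -> n (e d4) = e d2 ->
  #|porbits e| + 2 * ncomp e n > nverts n + nfaces e n.
Proof.
move=> ds uds eds n1 n2 n3 n4 ne1 ne3 ne2 ne4; have eKx := eK e2.
have /andP[] : (d1 \notin [:: d2; d3; d4]) && (d2 \notin [:: d3; d4]).
  by case/and3P: uds => -> ->.
rewrite !inE !negb_or => /and3P[d12 _ d14] /andP[_ d24].
have d41 : d4 != d1 by rewrite eq_sym.
have w x : x != d4 -> x != d1 -> (tperm d4 d1 * n)%g x = n x.
  by move=> x4 x1; rewrite permM tpermD // eq_sym.
have we x : x \in ds -> (tperm d4 d1 * n)%g (e x) = n (e x).
  move=> xds; have exds := eds x xds.
  by rewrite w //; apply: contraNneq exds => ->; rewrite !inE eqxx ?orbT.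
have link x : connect (glink e (tperm d4 d1 * n)%g) x (e x) := glink_e _ _ x.
have rot x : connect (glink e (tperm d4 d1 * n)%g) x ((tperm d4 d1 * n)%g x) := glink_rot _ _ x.
have : ~~ genus_le e n (tperm d4 d1 * n)%g.
  apply: genus_lt_tperm => //.
  - by rewrite porbit_sym -n4 (mem_porbit n 1).
  - rewrite porbit_sym; apply/porbitP; exists 6; rewrite permX /= !permM.
    by rewrite !(eKx, n4, ne1, n3, ne4, n2, ne3).
  apply: connect_trans (link _) _.
  apply: connect_trans (rot _) _; rewrite we ?ne4 ?inE ?eqxx ?orbT //.
  apply: connect_trans (link _) _; rewrite eKx.
  apply: connect_trans (rot _) _; rewrite w ?n2 // 1?eq_sym //.
  apply: connect_trans (link _) _.
  apply: connect_trans (rot _) _; rewrite we ?ne3 ?inE ?eqxx ?orbT //.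
  by apply: connect_trans (link _) _; rewrite eKx.
have := euler_le e2 (tperm d4 d1 * n)%g.
by rewrite /genus_le; lia.
Qed.

Lemma no_crossing (col : D -> option bool) (n n0 : {perm D}) c d1 d2 d3 d4 :
    nverts n0 + nfaces e n0 = #|porbits e| + 2 * ncomp e n0 ->
    genus_le e n n0 -> invariant_under n col ->
    uniq c -> fcycle n c -> subseq [:: d1; d2; d3; d4] c ->
    {in c, forall z, col z = None} ->
    col (e d1) = Some true -> col (e d2) = Some false ->
    col (e d3) = Some true -> col (e d4) = Some false ->
    joined e col n (e d1) (e d3) -> joined e col n (e d2) (e d4) ->
  False.
Proof.
move=> plane0 nn0 ncol uc nc sub_c cN col1 col2 col3 col4 j13 j24.
set ds := [:: d1; d2; d3; d4] in sub_c.
have uds : uniq ds := subseq_uniq sub_c uc.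
have dsN x : x \in ds -> col x = None by move/(mem_subseq sub_c)/cN.
have edsN x : x \in ds -> col (e x) by rewrite !inE => /or4P[]/eqP ->; rewrite ?col1 ?col2 ?col3 ?col4.
have eds : {in ds, forall x, e x \notin ds}.
  by move=> x /edsN; apply: contraL => /dsN ->.
have eKx := eK e2.
pose U x := (x \in ds) || (e x \in ds).
have U_e x : U (e x) = U x by rewrite /U eKx orbC.
have Uds x : x \in ds -> U x by rewrite /U => ->.
have Ueds x : x \in ds -> U (e x) by rewrite U_e; exact: Uds.
have U_mono z : col z -> col z = col (e z) -> ~~ U z /\ ~~ U (e z).
  rewrite U_e => z_col zE; suff z'U : ~~ U z by [].
  rewrite negb_or; apply/andP; split.
    by apply: contraTN z_col => /dsN ->.
  by move: z_col; rewrite zE; apply: contraTN => /dsN ->.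
have [m mn] := reduces_cycle e2 U (l := [::]) ncol uc nc cN.
have -> : [::] ++ filter U c = ds.
  rewrite (subseq_uniqP uc sub_c); apply: eq_in_filter => x xc.
  rewrite /U; case: (boolP (e x \in ds)) => [/edsN|]; last by rewrite orbF.
  by rewrite eKx cN.
case/and5P=> /eqP m1 /eqP m2 /eqP m3 /eqP m4 _.
have [_ mcol mj] := mn.
have [k [[km kcol kj] fix_k frame_k]] := reduces_all e2 e_neq U_e (enum D) mcol.
have in1 : d1 \in ds by rewrite !inE eqxx.
have in2 : d2 \in ds by rewrite !inE eqxx orbT.
have in3 : d3 \in ds by rewrite !inE eqxx !orbT.
have in4 : d4 \in ds by rewrite !inE eqxx !orbT.
have fixk x : ~~ U x -> k x = x by apply: fix_k; rewrite mem_enum.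
have Ucol x : U x -> col x -> exists2 d, d \in ds & x = e d.
  case/orP => [/dsN -> //|xds _]; by exists (e x); rewrite ?eKx.
have two13 x : U x -> col x = Some true -> x = e d1 \/ x = e d3.
  move=> Ux xT; have [|d] := Ucol x Ux; first by rewrite xT.
  by move=> + xE; rewrite xE in xT *; rewrite !inE => /or4P[]/eqP E; subst d;
    rewrite ?col2 ?col4 in xT; [left| |right|].
have two24 x : U x -> col x = Some false -> x = e d2 \/ x = e d4.
  move=> Ux xT; have [|d] := Ucol x Ux; first by rewrite xT.
  by move=> + xE; rewrite xE in xT *; rewrite !inE => /or4P[]/eqP E; subst d;
    rewrite ?col1 ?col3 in xT; [|left| |right].
have k13 : joined e col k (e d1) (e d3) by apply: kj; rewrite ?Ueds //; apply: mj; rewrite ?Ueds.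
have k24 : joined e col k (e d2) (e d4) by apply: kj; rewrite ?Ueds //; apply: mj; rewrite ?Ueds.
have d13 : e d1 != e d3.
  rewrite (inj_eq perm_inj); move: uds.
  by rewrite /= !inE !negb_or => /andP[/and3P[]].
have d24 : e d2 != e d4.
  rewrite (inj_eq perm_inj); move: uds.
  by rewrite /= !inE !negb_or => /and3P[_ /andP[]].
have two := joined_two U_mono kcol fixk.
have k1 : k d1 = d2 by rewrite frame_k ?m1 ?Uds.
have k2 : k d2 = d3 by rewrite frame_k ?m2 ?Uds.
have k3 : k d3 = d4 by rewrite frame_k ?m3 ?Uds.
have k4 : k d4 = d1 by rewrite frame_k ?m4 ?Uds.
have ke1 : k (e d1) = e d3.
  by apply: two; rewrite ?Ueds // col1; exact: two13.
have ke3 : k (e d3) = e d1.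
  apply: two; rewrite ?Ueds 1?eq_sym //; last exact: joined_sym.
  by move=> x Ux; rewrite col3 => /(two13 x Ux) []; [right|left].
have ke2 : k (e d2) = e d4.
  by apply: two; rewrite ?Ueds // col2; exact: two24.
have ke4 : k (e d4) = e d2.
  apply: two; rewrite ?Ueds 1?eq_sym //; last exact: joined_sym.
  by move=> x Ux; rewrite col4 => /(two24 x Ux) []; [right|left].
have kn0 : genus_le e k n0.
  by apply: genus_le_trans km _; apply: genus_le_trans nn0; case: mn.
have := crossing_genus uds eds k1 k2 k3 k4 ke1 ke3 ke2 ke4.
by move: plane0 kn0; rewrite /genus_le; clear; lia.
Qed.

End NoCrossing.

(** * Reduced graphs *)

Section Darts.
Variable G : sgraph.
Implicit Types (d x y : dart G) (n rot : {perm dart G}) (S K : {set G}) (M R : embmg G).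

Lemma revpE d : revp G d = rev d. Proof. by rewrite permE. Qed.

Lemma revp2 : (revp G * revp G = 1)%g.
Proof. by apply/permP => d; rewrite permM !revpE revK perm1. Qed.

Lemma revp_neq d : revp G d != d.
Proof.
rewrite revpE; apply/eqP => /(congr1 (fst \o val)) /= E.
by have := valP d; rewrite /= E adj_irr.
Qed.

Lemma skip_edgeP d n : skip_edge d n = pskip_edge (revp G) d n.
Proof. by rewrite /pskip_edge revpE. Qed.

Lemma rotation_system_fst rot d :
  rotation_system rot -> (val (rot d)).1 = (val d).1.
Proof. by move=> rot_sys; apply/eqP; rewrite -rot_sys (mem_porbit rot 1). Qed.

Lemma plane_embedding_genus rot : plane_embedding rot ->
  nverts rot + nfaces (revp G) rot =
  #|porbits (revp G)| + 2 * ncomp (revp G) rot.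
Proof.
move=> [_ plane_eq].
have cE : ncomp (revp G) rot =
    n_comp [rel d f | (f == rev d) || (f == rot d)] [pred _ : dart G | true].
  apply: eq_n_comp.
  apply: eq_connect => d f.
  by rewrite /glink /= revpE.
rewrite cE.
exact: plane_eq.
Qed.

Definition partial_reduction rot S M :=
  [/\ genus_le (revp G) (mrot M) rot,
      forall d, (val d).1 \notin S -> mrot M d = rot d,
      forall u : G, u \in S -> image M u \in S &
      forall u : G, u \notin S -> image M u = u].

Lemma partial_reduction_contract rot S M d :
    rotation_system rot -> d \in inside S -> partial_reduction rot S M ->
  partial_reduction rot S (contract M d).
Proof.
move=> rot_sys; rewrite inE => /andP[dS rdS] [genusM rotM imS imN].
have notd x : (val x).1 \notin S -> x \notin [:: d; revp G d].
  by move=> xS; rewrite !inE revpE; apply: contra xS => /orP[]/eqP ->.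
have frame n x : (forall y, (val y).1 \notin S -> n y = rot y) ->
    (val x).1 \notin S -> skip_edge d n x = rot x.
  move=> nrot xS; rewrite skip_edgeP (pskip_edge_frame revp_neq) ?nrot ?notd //.
  by rewrite rotation_system_fst.
rewrite /contract; case: ifP => _; split=> //=.
- rewrite skip_edgeP; apply: genus_le_trans genusM.
  exact: (genus_le_pskip_edge revp2).
- by move=> x xS; apply: frame.
- rewrite skip_edgeP -revpE; apply: genus_le_trans genusM.
  exact: (genus_le_contract revp2 revp_neq).
- move=> x xS; apply: frame => // y yS; rewrite permM tpermD ?rotM //.
    by have := notd y yS; rewrite !inE negb_or eq_sym => /andP[].
  by have := notd y yS; rewrite !inE negb_or revpE [y == rev d]eq_sym => /andP[].
- by move=> x xS; case: ifP => _; rewrite ?imS.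
move=> x xS; rewrite imN //; case: eqP => // xE.
by move: xS; rewrite xE imS.
Qed.

Lemma reduced_partial rot S R :
  rotation_system rot -> reduced rot S R -> partial_reduction rot S R.
Proof.
move=> rot_sys [s s_in ->].
have : {subset s <= inside S} by move=> d; rewrite (perm_mem s_in) mem_enum.
have : partial_reduction rot S (embmg_of rot) by split=> //; exact: genus_le_refl.
elim: s (embmg_of rot) {s_in} => //= d s IH M redM sS; apply: IH.
  by apply: partial_reduction_contract => //; apply: sS; rewrite mem_head.
by move=> x xs; apply: sS; rewrite inE xs orbT.
Qed.

Lemma joined_induced rot n S K (col : dart G -> option bool) b x y :
    rotation_system rot -> (forall d, (val d).1 \notin S -> n d = rot d) ->
    [disjoint K & S] -> connected (induced K) ->
    (forall d, (val d).1 \in K -> col d = Some b) ->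
    (val x).1 \in K -> (val y).1 \in K ->
  joined (revp G) col n x y.
Proof.
move=> rot_sys n_rot KS conK colK xK yK p np pe.
have same d f : (val d).1 \in K -> (val d).1 = (val f).1 -> p d = p f.
  move=> dK df; have /porbitP[i ->] : f \in porbit rot d by rewrite rot_sys df.
  elim: i => [|i IH]; first by rewrite perm1.
  have fst_i : (val ((rot ^+ i)%g d)).1 = (val d).1.
    by apply/eqP; rewrite -rot_sys mem_porbit.
  rewrite expgSr permM -n_rot ?np // fst_i.
  by rewrite (disjointFr KS dK).
case/connectP: (conK _ _ xK yK) => s.
elim: s x xK => [|a s IH] x xK /=; first by move=> _ /esym; apply: same.
case/andP=> /and3P[/= _ aK xa] sP ylast.
pose z : dart G := exist _ ((val x).1, a) xa.
rewrite (same x z) // pe ?colK ?revpE //.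
exact: IH.
Qed.

End Darts.

Theorem theorem10 (G : sgraph) (I : Type) (H : I -> subgraph G) :
  planar G -> non_piercing H -> cross_free H.
Proof.
move=> [rot plane] [_ nonpiercing]; exists rot; split=> // i j v vS R redR.
case=> [d1 [d2 [d3 [d4 [[_ at_v order_v] t1 t2 t3 t4]]]]].
have [rot_sys _] := plane.
have [genusR rotR imS imN] := reduced_partial rot_sys redR.
set S := sV (H i) :&: sV (H j) in vS redR rotR imS imN.
set A := sV (H i) :\: sV (H j) in t1 t3.
set B := sV (H j) :\: sV (H i) in t2 t4.
have AS : [disjoint A & S].
  by rewrite -setI_eq0; apply/eqP/setP => x; rewrite !inE; do 2!case: (_ \in _).
have BS : [disjoint B & S].
  by rewrite -setI_eq0; apply/eqP/setP => x; rewrite !inE; do 2!case: (_ \in _).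
have AB : [disjoint A & B].
  by rewrite -setI_eq0; apply/eqP/setP => x; rewrite !inE; do 2!case: (_ \in _).
pose vcol x := if x \in A then Some true else if x \in B then Some false else None.
pose col (d : dart G) := vcol (val d).1.
have vcolA x : x \in A -> vcol x = Some true by rewrite /vcol => ->.
have vcolB x : x \in B -> vcol x = Some false.
  by move=> xB; rewrite /vcol (disjointFl AB xB) xB.
have vcolS x : x \in S -> vcol x = None.
  by move=> xS; rewrite /vcol (disjointFl AS xS) (disjointFl BS xS).
have target_val (d : dart G) (K : {set G}) : [disjoint K & S] -> target R d \in K -> (val d).2 \in K.
  rewrite /target => KS tK; have [/imS dS|/imN <- //] := boolP ((val d).2 \in S).
  by rewrite (disjointFr KS tK) in dS.
have rotS x : (val x).1 \in S -> (val (mrot R x)).1 \in S.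
  apply: contraTT => nxS; have rx : mrot R ((rot^-1)%g (mrot R x)) = mrot R x.
    rewrite rotR ?permKV // -(rotation_system_fst _ rot_sys) permKV //.
  by rewrite -(perm_inj rx) -(rotation_system_fst _ rot_sys) permKV.
have ncol : invariant_under (mrot R) col.
  move=> x; have [xS|xS] := boolP ((val x).1 \in S).
    by rewrite /col !vcolS // rotS.
  by rewrite /col rotR // rotation_system_fst.
have sub_v d : d \in [:: d1; d2; d3; d4] -> (val d).1 \in S.
  move/at_v; rewrite /origin => dv; have := imS v vS; rewrite -dv.
  by apply: contraLR => dS; rewrite imN.
apply: (no_crossing (revp2 G) (@revp_neq G) (col := col) (n := mrot R) (n0 := rot)
  (c := orbit (mrot R) d1) (d1 := d1) (d2 := d2) (d3 := d3) (d4 := d4)) => //.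
- exact: plane_embedding_genus plane.
- exact/cycle_orbit/perm_inj.
- move=> z; rewrite -fconnect_orbit => d1z.
  rewrite -(fconnect_invariant _ d1z); last by move=> t; rewrite /= ncol eqxx.
  by apply: vcolS; apply: sub_v; rewrite mem_head.
- by rewrite /col revpE vcolA // (target_val _ A).
- by rewrite /col revpE vcolB // (target_val _ B).
- by rewrite /col revpE vcolA // (target_val _ A).
- by rewrite /col revpE vcolB // (target_val _ B).
- apply: (joined_induced rot_sys rotR AS (nonpiercing i j) (b := true)).
  + by move=> d; apply: vcolA.
  + by rewrite revpE (target_val _ A).
  + by rewrite revpE (target_val _ A).
apply: (joined_induced rot_sys rotR BS (nonpiercing j i) (b := false)).
+ by move=> d; apply: vcolB.
+ by rewrite revpE (target_val _ B).
+ by rewrite revpE (target_val _ B).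
Qed.
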